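(* Let $\mathcal{Q}$ be a non-principal ultrafilter on $\mathbb{N}$ and let $\{\varepsilon_n\}_{n\in\mathbb{N}}$ be a sequence of positive real numbers tending to $0$. Let $X\subset\mathbb{R}^p$ and $Y\subset\mathbb{R}^q$ be nonempty bounded sets. Then the nonstandard Minkowski dimensions relative to $\mathcal{Q},\{\varepsilon_n\}$ satisfy $$\dim_{\mathcal{Q},\varepsilon_n}(X\times Y)=\dim_{\mathcal{Q},\varepsilon_n}(X)+\dim_{\mathcal{Q},\varepsilon_n}(Y),$$ where $X\times Y\subset\mathbb{R}^{p+q}$ is the Cartesian product.
   Context: Dyadic covering number: for $k\in\mathbb{Z}$ and $d\ge 1$, the dyadic cubes of side length $2^{-k}$ in $\mathbb{R}^d$ are the sets $[m_12^{-k},(m_1+1)2^{-k})\times\cdots\times[m_d2^{-k},(m_d+1)2^{-k})$ with $m_1,\dots,m_d\in\mathbb{Z}$. For a bounded set $A\subset\mathbb{R}^d$, $S_A(2^{-k})$ is the minimal number of dyadic cubes of side length $2^{-k}$ needed to cover $A$. For arbitrary real $\varepsilon>0$ set $S_A(\varepsilon)=S_A(2^{-k})$, where $k\in\mathbb{Z}$ is the unique integer with $2^{-(k+1)}<\varepsilon\le 2^{-k}$. Ultralimit: a non-principal ultrafilter on $\mathbb{N}$ is a proper filter $\mathcal{Q}$ on $\mathbb{N}$ such that for every $E\subset\mathbb{N}$ either $E\in\mathcal{Q}$ or $\mathbb{N}\setminus E\in\mathcal{Q}$, and such that no finite set belongs to $\mathcal{Q}$. For a bounded real sequence $\{a_n\}$,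 $\lim_{\mathcal{Q}}a_n$ is the unique real number $l$ such that $\{n: a_n\in U\}\in\mathcal{Q}$ for every open interval $U$ containing $l$. Since $\mathcal{Q}$ is non-principal, finitely many terms of the sequence may be disregarded (so it suffices that the sequence be defined and bounded for all large $n$). Nonstandard Minkowski dimension: for a nonempty bounded $A\subset\mathbb{R}^d$, $$\dim_{\mathcal{Q},\varepsilon_n}(A)=\lim_{\mathcal{Q}}\frac{\log S_A(\varepsilon_n)}{\log(1/\varepsilon_n)}.$$ *)

(* Defs.v *)
From mathcomp Require Import all_boot all_order all_algebra.
From mathcomp Require Import all_classical all_reals all_analysis.

Set Implicit Arguments.
Unset Strict Implicit.
Unset Printing Implicit Defensive.

Import Order.TTheory GRing.Theory Num.Theory.
Import numFieldNormedType.Exports.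

Local Open Scope classical_set_scope.
Local Open Scope ring_scope.

Definition dyadic_cube (R : realType) (d : nat) (k : int) (m : 'rV[int]_d) :
    set 'rV[R]_d :=
  [set x : 'rV[R]_d | forall i, (m ord0 i)%:~R * 2 ^ (- k) <= x ord0 i
                               < (m ord0 i + 1)%:~R * 2 ^ (- k)].

Definition dyadic_cubes (R : realType) (d : nat) (k : int) :
    set (set 'rV[R]_d) :=
  [set dyadic_cube k m | m in [set: 'rV[int]_d]].

Definition dyadic_coverable (R : realType) (d : nat) (A : set 'rV[R]_d)
    (k : int) (N : nat) : Prop :=
  exists C : set (set 'rV[R]_d),
    [/\ C `<=` dyadic_cubes k, (C #= `I_N)%card
      & A `<=` \bigcup_(D in C) D].

(* The least N for which A is covered by N cubes; it exists when A is bounded,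
   and the value is 0 by default when there is none. *)
Definition dyadic_covering_number (R : realType) (d : nat) (A : set 'rV[R]_d)
    (k : int) : nat :=
  xget 0%N [set N | dyadic_coverable A k N /\
                    forall M, dyadic_coverable A k M -> (N <= M)%N].

(* For e > 0 exactly one integer satisfies the condition. *)
Definition dyadic_index (R : realType) (e : R) : int :=
  xget 0 [set k : int | 2 ^ (- (k + 1)) < e <= 2 ^ (- k)].

Definition covering_number (R : realType) (d : nat) (A : set 'rV[R]_d)
    (e : R) : nat :=
  dyadic_covering_number A (dyadic_index e).

Record nonprincipal_ultrafilter (Q : set_system nat) : Prop := {
  nonprincipal_ultra : UltraFilter Q ;
  nonprincipal_finite : forall E : set nat, finite_set E -> ~ Q E }.

(* UltraFilter is defined by maximality among proper filters. *)
Lemma ultraFilterP (Q : set_system nat) :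
  UltraFilter Q <-> ProperFilter Q /\ forall E : set nat, Q E \/ Q (~` E).
Proof.
split=> [UQ|[PQ QE]].
  by split; [exact: ultra_proper | move=> E; exact: in_ultra_setVsetC].
split=> // G PG QG; apply/seteqP; split=> // E GE.
have [//|/QG GCE] := QE E.
have := @filterI _ _ PG _ _ GE GCE; rewrite setICr => G0.
by case: (@filter_not_empty _ _ PG).
Qed.

(* The unique limit when the sequence is bounded along Q; as usual for [lim],
   a default value when the sequence does not converge along Q. *)
Definition ultralim (R : realType) (Q : set_system nat) (a : nat -> R) : R :=
  lim (a @ Q).

Definition nonstd_minkowski_dim (R : realType) (d : nat) (Q : set_system nat)
    (eps : nat -> R) (A : set 'rV[R]_d) : R :=
  ultralim Q (fun n => ln (covering_number A (eps n))%:R / ln (1 / eps n)).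

(* The Cartesian product, with R^p x R^q identified with R^(p + q). *)
Definition cartesian_prod (R : realType) (p q : nat) (X : set 'rV[R]_p)
    (Y : set 'rV[R]_q) : set 'rV[R]_(p + q) :=
  [set row_mx x y | x in X & y in Y].

(* Main.v *)
(** A point x lies in exactly one dyadic cube of side 2^-k, the one indexed by
    the vector of floors of 2^k x_i, so S_A(2^-k) is the number of distinct
    index vectors of points of A.  The index vectors of X x Y are the pairs of
    index vectors of X and of Y, hence S_(X x Y) = S_X S_Y exactly, and the
    logarithmic ratios add term by term.  Each ratio is bounded for small
    epsilon because S_A(2^-K) <= ((2M+1) 2^K)^d when |x_i| <= M on A, so both
    ultralimits exist and the limit of the sum is the sum of the limits. *)
Require Import Defs.
From mathcomp Require Import all_boot all_order all_algebra finmap.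
From mathcomp Require Import all_classical all_reals all_analysis.
From mathcomp Require Import zify.
Import Order.TTheory GRing.Theory Num.Theory.
Import numFieldNormedType.Exports.
Set Implicit Arguments.
Unset Strict Implicit.
Unset Printing Implicit Defensive.
Local Open Scope classical_set_scope.
Local Open Scope ring_scope.

(** * Dyadic cells and the exact covering number *)

Definition dyadic_cell (R : realType) (d : nat) (k : int) (x : 'rV[R]_d) :
    'rV[int]_d :=
  \row_i Num.floor (x ord0 i * 2 ^ k).
Arguments dyadic_cell {R d}.

(** Multiplying by [2 ^ k] turns each half-open coordinate condition into the characterization of a
    floor. The cubes are thus the fibres of one map. *)
Lemma dyadic_cubeE (R : realType) (d : nat) (k : int) (m : 'rV[int]_d) :
  dyadic_cube k m = [set x : 'rV[R]_d | dyadic_cell k x = m].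
Proof.
have k0 : (0 : R) < 2 ^ k by rewrite exprz_gt0.
have cubeP (a : int) (t : R) :
    a%:~R * 2 ^ (- k) <= t < (a + 1)%:~R * 2 ^ (- k) =
    (Num.floor (t * 2 ^ k) == a).
  by rewrite floor_eq -invr_expz ler_pdivrMr// ltr_pdivlMr.
apply/seteqP; split => x /=.
  by move=> xm; apply/rowP => i; rewrite mxE; apply/eqP; rewrite -cubeP.
by move=> <- i; rewrite cubeP mxE.
Qed.

Lemma dyadic_cube_inj (R : realType) (d : nat) (k : int) :
  injective (@dyadic_cube R d k).
Proof.
move=> m n; rewrite !dyadic_cubeE => mn.
pose x : 'rV[R]_d := \row_i ((m ord0 i)%:~R * 2 ^ (- k)).
have xm : dyadic_cell k x = m.
  apply/rowP => i; rewrite !mxE -mulrA -expfzDr// addNr expr0z mulr1.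
  by rewrite intrKfloor.
by have : [set x : 'rV[R]_d | dyadic_cell k x = m] x by []; rewrite mn /= xm.
Qed.

(** The cubes of the occupied cells cover [A]. Conversely a cube of any cover that contains [x] must
    be the cube of the cell of [x], so every cover contains all of these. *)
Lemma dyadic_covering_numberE (R : realType) (d : nat) (A : set 'rV[R]_d)
    (k : int) (n : nat) :
  (dyadic_cell k @` A #= `I_n)%card -> dyadic_covering_number A k = n.
Proof.
move=> cardA.
have cardC : (@dyadic_cube R d k @` (dyadic_cell k @` A) #= `I_n)%card.
  apply: (card_eq_trans _ cardA);
  by apply: inj_card_eq => ? ? _ _; exact: dyadic_cube_inj.
have covn : dyadic_coverable A k n.
  exists (@dyadic_cube R d k @` (dyadic_cell k @` A)); split => //.
    by move=> _ [m _ <-]; exists m.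
  move=> x Ax; exists (dyadic_cube k (dyadic_cell k x)).
    by exists (dyadic_cell k x) => //; exists x.
  by rewrite dyadic_cubeE.
have minn M : dyadic_coverable A k M -> (n <= M)%N.
  move=> [C [Ck CM AC]].
  rewrite -card_le_II -(card_le_eqr CM) -(card_le_eql cardC).
  apply: subset_card_le => _ [_ [x Ax <-] <-].
  have [D CD Dx] := AC _ Ax.
  have [m _ mD] := Ck _ CD.
  by move: Dx; rewrite -mD dyadic_cubeE /= => ->; rewrite mD.
(* The default value is excluded because [n] itself is a least cover size. *)
rewrite /dyadic_covering_number;
case: xgetP => [N -> [/minn nN /(_ _ covn) Nn]|/(_ n)].
  by apply/eqP; rewrite eqn_leq Nn.
by case.
Qed.

Lemma card_setX (T U : choiceType) (A : set T) (B : set U) (a b : nat) :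
  (A #= `I_a)%card -> (B #= `I_b)%card -> (A `*` B #= `I_(a * b))%card.
Proof.
move=> cA cB.
have fA : finite_set A by apply/finite_setP; exists a.
have fB : finite_set B by apply/finite_setP; exists b.
rewrite -(fset_setK (finite_setX fA fB)); apply/card_eq_fsetP.
rewrite fset_setX// -(card_fset_set cA) -(card_fset_set cB) -(size_allpairs pair).
(* The list of all pairs is a duplicate-free enumeration of the product. *)
apply/perm_size/uniq_perm; first exact: fset_uniq.
  by apply: allpairs_uniq; [exact: fset_uniq|exact: fset_uniq|move=> [? ?] []].
move=> [x y]; rewrite in_fsetM /=; apply/andP/allpairsP.
  by move=> [xA yB]; exists (x, y).
by move=> [[? ?] /= [? ? [-> ->]]].
Qed.

(** * Covering numbers of products *)

Lemma dyadic_cell_row_mx (R : realType) (p q : nat) (k : int)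
    (x : 'rV[R]_p) (y : 'rV[R]_q) :
  dyadic_cell k (row_mx x y) = row_mx (dyadic_cell k x) (dyadic_cell k y).
Proof.
by apply/rowP => i; rewrite !mxE; case: splitP => j _; rewrite mxE.
Qed.

Lemma dyadic_covering_number_prod (R : realType) (p q : nat) (k : int)
    (X : set 'rV[R]_p) (Y : set 'rV[R]_q) :
  finite_set (dyadic_cell k @` X) ->
  finite_set (dyadic_cell k @` Y) ->
  dyadic_covering_number (cartesian_prod X Y) k =
  (dyadic_covering_number X k * dyadic_covering_number Y k)%N.
Proof.
move=> /finite_setP[a cX] /finite_setP[b cY].
rewrite (dyadic_covering_numberE cX) (dyadic_covering_numberE cY).
apply: dyadic_covering_numberE; apply: (card_eq_trans _ (card_setX cX cY)).
have -> : dyadic_cell k @` cartesian_prod X Y =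
    (fun z => row_mx z.1 z.2) @` ((dyadic_cell k @` X) `*` (dyadic_cell k @` Y)).
  apply/seteqP; split => m /=.
    move=> [_ [x Xx [y Yy <-]] <-]; rewrite dyadic_cell_row_mx.
    by exists (dyadic_cell k x, dyadic_cell k y) => //;
      split; [exists x|exists y].
  move=> [[_ _] /= [[x Xx <-] [y Yy <-]] <-]; exists (row_mx x y).
    by exists x => //; exists y.
  by rewrite dyadic_cell_row_mx.
by apply: inj_card_eq => -[? ?] [? ?] _ _ /= /eq_row_mx[-> ->].
Qed.

(** * Bounds on the covering number of a bounded set *)

Lemma bounded_set_entry (R : realType) (d : nat) (A : set 'rV[R]_d) :
  bounded_set A ->
  exists M : nat, forall x, A x -> forall i, `|x ord0 i| <= M%:R.
Proof.
move=> /pinfty_ex_gt0[M M0 AM]; exists (Num.bound M) => x Ax i.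
apply: le_trans (ltW (archi_boundP (ltW M0))).
apply: le_trans (AM _ Ax); rewrite [leRHS]/Num.norm /= mx_normrE.
exact: (@le_bigmax _ _ _ _ (fun ij : 'I_1 * 'I_d => `|x ij.1 ij.2|) (ord0, i)).
Qed.

Lemma card_finType (T : finType) : ([set: T] #= `I_#|T|)%card.
Proof.
rewrite card_eq_sym; apply: card_eq_trans card_II _.
rewrite -(_ : @enum_val T predT @` setT = setT).
  by rewrite card_eq_sym; apply: inj_card_eq => i j _ _; exact: enum_val_inj.
by apply/seteqP; split => // t _; exists (enum_rank t) => //; exact: enum_rankK.
Qed.

Lemma card_dyadic_cell_le (R : realType) (d : nat) (A : set 'rV[R]_d)
    (M K : nat) :
  (forall x, A x -> forall i, `|x ord0 i| <= M%:R) ->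
  (dyadic_cell (K : int) @` A #<= `I_(((2 * M + 1) * 2 ^ K) ^ d))%card.
Proof.
(* Between [- M * 2 ^ K] and [M * 2 ^ K] lie [2 * M * 2 ^ K + 1] integers. The bound [L] is at least
   this and is a product, so its logarithm splits. *)
move=> AM; set L := ((2 * M + 1) * 2 ^ K)%N.
(* Shifting by [M * 2 ^ K] encodes every occupied cell as a function into ['I_L]. *)
pose g (f : {ffun 'I_d -> 'I_L}) : 'rV[int]_d :=
  \row_i ((f i : nat)%:Z - (M * 2 ^ K)%N%:Z).
have : (g @` setT #<= `I_(L ^ d))%card.
  apply: card_le_trans (card_image_le _ _) _.
  have := card_finType {ffun 'I_d -> 'I_L}.
  by rewrite card_ffun !card_ord => /card_eqPle[].
apply: card_le_trans; apply: subset_card_le => _ [x Ax <-].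
have bnd i :
    - (M * 2 ^ K)%N%:Z <= Num.floor (x ord0 i * 2 ^ (K : int)) <=
    (M * 2 ^ K)%N%:Z.
  have K0 : (0 : R) <= 2 ^+ K by rewrite exprn_ge0.
  have := AM _ Ax i; rewrite ler_norml -exprnP => /andP[lo hi].
  apply/andP; split.
    rewrite floor_ge_int rmorphN /= -pmulrn natrM natrX -mulNr.
    exact: ler_wpM2r.
  rewrite -ltzD1 floor_lt_int intrD -pmulrn natrM natrX ltr_pwDr//.
  exact: ler_wpM2r.
have K0 : (0 < 2 ^ K)%N by rewrite expn_gt0.
have ltL i :
    (absz (Num.floor (x ord0 i * 2 ^ (K : int)) + (M * 2 ^ K)%N%:Z)%R < L)%N.
  have := bnd i; rewrite /L; nia.
exists [ffun i => Ordinal (ltL i)] => //; apply/rowP => i; rewrite !mxE ffunE /=.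
have := bnd i; lia.
Qed.

Lemma bounded_finite_dyadic_cell (R : realType) (d : nat) (A : set 'rV[R]_d)
    (K : nat) :
  bounded_set A -> finite_set (dyadic_cell (K : int) @` A).
Proof.
move=> /bounded_set_entry[M AM].
exact: card_le_finite (card_dyadic_cell_le K AM) (finite_II _).
Qed.

(** A scale [e <= 1] has a nonnegative index. The bound on [2 ^+ K] later lets [ln e^-1] dominate
    [ln (2 ^ K)]. *)
Lemma dyadic_index_nat (R : realType) (e : R) :
  0 < e <= 1 ->
  exists2 K : nat, dyadic_index e = K & 2 ^+ K <= e^-1.
Proof.
move=> /andP[e0 e1].
have [n /andP[lo hi]] : exists n : nat, 2 ^- n.+1 < e <= 2 ^- n.
  have ex : exists n : nat, 2 ^- n < e.
    exists (Num.bound e^-1); rewrite invf_plt ?posrE ?exprn_gt0//.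
    apply: lt_trans (archi_boundP _) _; first by rewrite invr_ge0 ltW.
    by rewrite -natrX ltr_nat ltn_expl.
  (* The least exponent with [2 ^- n < e] is positive since [e <= 1]; its predecessor is the
     index. *)
  case: (ex_minnP ex) => -[|n] hn nmin.
    by move: hn; rewrite expr0 invr1 ltNge e1.
  by exists n; rewrite hn leNgt; apply/negP => /nmin; rewrite ltnn.
rewrite /dyadic_index; set S := [set k : int | _].
have Sn : S n by rewrite /S /= addrC -intS -!exprnN lo.
have := xgetPex 0 (ex_intro S _ Sn).
move: (xget 0 S) => k {Sn} /andP[klo khi].
have : 0 <= k.
  rewrite -ltzD1 -[k + 1]opprK oppr_gt0.
  have := lt_le_trans klo e1; rewrite -[ltRHS](expr0z (2 : R)).
  by rewrite ltr_eXz2l// ?ltr1n.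
case: k klo khi => // K _ khi _; exists K => //.
by rewrite -[leLHS]invrK lef_pV2 ?posrE ?invr_gt0 ?exprn_gt0// exprnP invr_expz.
Qed.

Lemma covering_number_gt0 (R : realType) (d : nat) (A : set 'rV[R]_d) (e : R) :
  A !=set0 -> bounded_set A -> 0 < e <= 1 -> (0 < covering_number A e)%N.
Proof.
move=> [a Aa] bA /dyadic_index_nat[K eK _].
have /finite_setP[n cn] := bounded_finite_dyadic_cell K bA.
rewrite /covering_number eK (dyadic_covering_numberE cn) lt0n.
apply/negP => /eqP n0; move: cn; rewrite n0 II0 card_eq0.
by apply/negP/set0P; exists (dyadic_cell K a); exists a.
Qed.

(** The count is at least 1 and its logarithm at most [d] times [B + ln (1 / e)]. The restriction
    [e <= 2^-1] keeps the denominator above [ln 2], so [B] is at most [B / ln 2] times it. *)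
Lemma log_covering_number_ratio_bounded (R : realType) (d : nat)
    (A : set 'rV[R]_d) :
  A !=set0 -> bounded_set A ->
  exists C : R, forall e : R, 0 < e <= 2^-1 ->
    0 <= ln (covering_number A e)%:R / ln (1 / e) <= C.
Proof.
move=> A0 bA; have [M AM] := bounded_set_entry bA.
have ln2 : 0 < ln 2 :> R by rewrite ln_gt0// ltr1n.
pose B : R := ln (2 * M + 1)%N%:R.
have B0 : 0 <= B by rewrite ln_ge0// ler1n addn1.
exists ((B / ln 2 + 1) *+ d) => e /andP[e0 e2].
have e1 : 0 < e <= 1 by rewrite e0 (le_trans e2)// invf_le1// ler1n.
have [K eK Ke] := dyadic_index_nat e1.
have n0 := covering_number_gt0 A0 bA e1.
have le2 : ln 2 <= ln e^-1 :> R.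
  by rewrite ler_ln ?posrE ?invr_gt0// -[leLHS]invrK lef_pV2 ?posrE ?invr_gt0.
have le0 : 0 < ln e^-1 by apply: lt_le_trans le2.
have nle : (covering_number A e <= ((2 * M + 1) * 2 ^ K) ^ d)%N.
  rewrite /covering_number eK.
  have cardA := card_dyadic_cell_le K AM.
  have /finite_setP[n cn] := card_le_finite cardA (finite_II _).
  by rewrite (dyadic_covering_numberE cn) -card_le_II -(card_le_eql cn).
rewrite div1r; apply/andP; split.
  by rewrite divr_ge0 ?(ltW le0)// ln_ge0// ler1n.
rewrite ler_pdivrMr//.
have L0 : (0 < (2 * M + 1) * 2 ^ K)%N by rewrite muln_gt0 expn_gt0 addn1.
have /le_trans : ln (covering_number A e)%:R <=
    ln ((((2 * M + 1) * 2 ^ K) ^ d)%N%:R) :> R.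
  by rewrite ler_ln ?posrE ?ltr0n ?ler_nat// expn_gt0 L0.
apply; rewrite natrX lnXn ?ltr0n//.
rewrite mulrnAl lerMn2r; apply/orP; right.
rewrite natrM lnM ?posrE ?ltr0n ?expn_gt0 ?addn1//.
rewrite -[in ln _](addn1 (2 * M)) -/B.
rewrite mulrDl mul1r lerD//.
  by rewrite mulrAC ler_pdivlMr// ler_wpM2l.
by rewrite ler_ln ?posrE ?ltr0n ?expn_gt0 ?invr_gt0// natrX.
Qed.

(** * Limits along ultrafilters *)

Lemma ultra_bounded_cvg (R : realType) (T : Type) (Q : set_system T)
    (UQ : UltraFilter Q) (a : T -> R) (C : R) :
  (\forall n \near Q, 0 <= a n <= C) -> cvg (a @ Q).
Proof.
move=> aC.
have : (a @ Q) `[0, C]%classic.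
  by apply: filterS aC => n /=; rewrite in_itv.
(* Compactness gives a cluster point [l]. If the preimage of a neighbourhood [U] were not in [Q],
   its complement would be, and [U] would meet its own complement. *)
move=> /(@segment_compact R 0 C (a @ Q) _)[l [_ cl]].
apply/cvg_ex; exists l => U lU.
have [//|QU] := in_ultra_setVsetC (a @^-1` U) UQ.
by have [x []] := cl (~` U) U QU lU.
Qed.

Lemma nonprincipal_ultrafilter_eventually (Q : set_system nat) :
  nonprincipal_ultrafilter Q -> \oo `<=` Q.
Proof.
move=> [UQ Qfin] E [N _ NE].
have /ultraFilterP[_ /(_ E)[//|QE]] := UQ; exfalso; apply: Qfin QE.
apply: sub_finite_set (finite_II N) => n /= nE; rewrite ltnNge.
by apply/negP => /NE.
Qed.

Theorem theorem3p10 (R : realType) (p q : nat) (hp : (0 < p)%N) (hq : (0 < q)%N)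
    (Q : set_system nat) (hQ : nonprincipal_ultrafilter Q)
    (eps : nat -> R) (eps_gt0 : forall n, 0 < eps n)
    (eps_cvg0 : eps @ \oo --> (0 : R))
    (X : set 'rV[R]_p) (Y : set 'rV[R]_q)
    (hX0 : X !=set0) (hY0 : Y !=set0)
    (hXb : bounded_set X) (hYb : bounded_set Y) :
  nonstd_minkowski_dim Q eps (cartesian_prod X Y) =
  nonstd_minkowski_dim Q eps X + nonstd_minkowski_dim Q eps Y.
Proof.
have UQ := nonprincipal_ultra hQ.
have PQ : ProperFilter Q by exact: ultra_proper.
(* The threshold [2^-1] is the one below which the ratios are bounded. *)
have epsQ : \forall n \near Q, 0 < eps n <= 2^-1.
  apply: (nonprincipal_ultrafilter_eventually hQ).
  move/cvgrPdist_le: eps_cvg0 => /(_ 2^-1); rewrite invr_gt0 ltr0n => /(_ isT).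
  by apply: filterS => n; rewrite sub0r normrN gtr0_norm ?eps_gt0.
have [CX hX] := log_covering_number_ratio_bounded hX0 hXb.
have [CY hY] := log_covering_number_ratio_bounded hY0 hYb.
have cvgX :
    cvg ((fun n => ln (covering_number X (eps n))%:R / ln (1 / eps n)) @ Q).
  by apply: (@ultra_bounded_cvg _ _ _ _ _ CX); apply: filterS epsQ => n /hX.
have cvgY :
    cvg ((fun n => ln (covering_number Y (eps n))%:R / ln (1 / eps n)) @ Q).
  by apply: (@ultra_bounded_cvg _ _ _ _ _ CY); apply: filterS epsQ => n /hY.
rewrite /nonstd_minkowski_dim /ultralim.
(* The ratio of the product agrees along [Q] with the sum of the two ratios and inherits its
   limit. *)
apply/cvg_lim => //; apply: cvg_trans (cvgD cvgX cvgY).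
apply: near_eq_cvg; apply: filterS epsQ => n /andP[en0 en2] /=.
have en1 : 0 < eps n <= 1 by rewrite en0 (le_trans en2)// invf_le1// ler1n.
have [K eK _] := dyadic_index_nat en1.
have -> : covering_number (cartesian_prod X Y) (eps n) =
    (covering_number X (eps n) * covering_number Y (eps n))%N.
  by rewrite /covering_number eK dyadic_covering_number_prod//;
    exact: bounded_finite_dyadic_cell.
(* The logarithm splits because non-emptiness makes both counts positive. *)
rewrite natrM lnM ?posrE ?ltr0n; [|exact: covering_number_gt0..].
by rewrite mulrDl.
Qed.
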